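(* Let $n\ge1$. For hyperhermitian matrices $\mathcal{M}_1,\ldots,\mathcal{M}_n\in M_{\mathbb{H}}(n,n)$, we have $$2^n\,n!\,\det(\mathcal{M}_1,\ldots,\mathcal{M}_n)=\triangle_n\bigl(\tau(\mathcal{M}_1)J,\ldots,\tau(\mathcal{M}_n)J\bigr),$$ where the left-hand side is the mixed discriminant associated with the Moore determinant.
   Context: $M_{\mathbb{F}}(p,m)$ is the space of $p\times m$ matrices over $\mathbb{F}$. A quaternionic matrix $\mathcal{M}=(\mathcal{M}_{jk})\in M_{\mathbb{H}}(n,n)$ is hyperhermitian if $\mathcal{M}_{jk}=\overline{\mathcal{M}_{kj}}$ (quaternionic conjugate). Embedding $\tau:M_{\mathbb{H}}(p,m)\to M_{\mathbb{C}}(2p,2m)$: write $\mathcal{M}=a+b\mathbf{j}$ with $a,b\in M_{\mathbb{C}}(p,m)$ and put $\tau(\mathcal{M})=\begin{pmatrix}a&-b\\ \overline{b}&\overline{a}\end{pmatrix}$. Let $J=\begin{pmatrix}0&I_n\\-I_n&0\end{pmatrix}$. Moore determinant: for a hyperhermitian $\mathcal{M}\in M_{\mathbb{H}}(n,n)$ there is a quaternionic unitary $\mathcal{E}$ (i.e. $\mathcal{E}^*\mathcal{E}=\mathcal{E}\mathcal{E}^*=I_n$, $\mathcal{E}^*=\overline{\mathcal{E}}^t$) with $\mathcal{E}^*\mathcal{M}\mathcal{E}=\mathrm{diag}(\nu_0,\ldots,\nu_{n-1})$, $\nu_l\in\mathbb{R}$; the Moore determinant is the real number $\det\mathcal{M}=\nu_0\cdots\nu_{n-1}$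 (independent of choices; it is a homogeneous polynomial of degree $n$ on the real vector space of hyperhermitian matrices). Mixed discriminant: for hyperhermitian $\mathcal{M}_1,\ldots,\mathcal{M}_n$, the expression $\det(\lambda_1\mathcal{M}_1+\cdots+\lambda_n\mathcal{M}_n)$ is a homogeneous polynomial of degree $n$ in the real variables $\lambda_1,\ldots,\lambda_n$; $\det(\mathcal{M}_1,\ldots,\mathcal{M}_n)$ denotes the coefficient of $\lambda_1\cdots\lambda_n$ divided by $n!$. Definition of $\triangle_n$: fix a basis $\{\omega^0,\ldots,\omega^{2n-1}\}$ of $\mathbb{C}^{2n}$ and set $\Omega_{2n}=\omega^0\wedge\omega^{n}\wedge\omega^1\wedge\omega^{n+1}\wedge\cdots\wedge\omega^{n-1}\wedge\omega^{2n-1}\in\wedge^{2n}\mathbb{C}^{2n}$. For skew-symmetric $M^{(t)}\in M_{\mathbb{C}}(2n,2n)$, $t=1,\ldots,n$, such that the $2$-forms $\omega_t=\sum_{A,B=0}^{2n-1}M^{(t)}_{AB}\,\omega^A\wedge\omega^B$ are real, $\triangle_n(M^{(1)},\ldots,M^{(n)})$ is defined by $$\triangle_n(M^{(1)},\ldots,M^{(n)})\,\Omega_{2n}=\omega_1\wedge\cdots\wedge\omega_n .$$ Here a form is real if it is fixed by the map $\rho(\mathbf{j})$ given on $\mathbb{C}^{2n}$ by $\rho(\mathbf{j})(z\omega^A)=\overline{z}\sum_B J_{AB}\,\omega^B$ and extended to exterior powers by acting on each factor. For hyperhermitian $\mathcal{M}$, the matrix $\tau(\mathcal{M})J$ is skew-symmetric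 and its $2$-form is real, so $\triangle_n$ applies. *)

(* Defs.v *)
From HB Require Import structures.
From mathcomp Require Import all_boot all_order all_algebra ring.
From mathcomp Require Import boolp classical_sets reals.
From mathcomp Require Import complex mpoly.

Set Implicit Arguments.
Unset Strict Implicit.
Unset Printing Implicit Defensive.

Import Order.TTheory GRing.Theory Num.Theory.
Local Open Scope ring_scope.
Local Open Scope complex_scope.

(* The quaternion [Quat a b] is a + b j, with a and b complex.             *)
Record quat (R : realType) : Type := Quat { qa : R[i]; qb : R[i] }.

Section QuaternionRing.
Variable R : realType.
Local Notation H := (quat R).
Implicit Types x y z : H.

Definition pair_of_quat x := (qa x, qb x).
Definition quat_of_pair (p : R[i] * R[i]) : H := Quat p.1 p.2.
Lemma pair_of_quatK : cancel pair_of_quat quat_of_pair.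
Proof. by case. Qed.

HB.instance Definition _ := Choice.copy H (can_type pair_of_quatK).

Definition addq x y : H := Quat (qa x + qa y) (qb x + qb y).
Definition oppq x : H := Quat (- qa x) (- qb x).
(* j c = c^* j for c complex, and j j = -1. *)
Definition mulq x y : H :=
  Quat (qa x * qa y - qb x * (qb y)^*%R) (qa x * qb y + qb x * (qa y)^*%R).

Lemma addqA : associative addq.
Proof. by move=> x y z; rewrite /addq /= !addrA. Qed.
Lemma addqC : commutative addq.
Proof. by move=> x y; rewrite /addq addrC [qb x + _]addrC. Qed.
Lemma add0q : left_id (Quat 0 0) addq.
Proof. by case=> a b; rewrite /addq /= !add0r. Qed.
Lemma addNq : left_inverse (Quat 0 0) oppq addq.
Proof. by case=> a b; rewrite /addq /= !addNr. Qed.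

HB.instance Definition _ := GRing.isZmodule.Build H addqA addqC add0q addNq.

Lemma mulqA : associative mulq.
Proof.
move=> [a b] [c d] [e f]; rewrite /mulq /=.
by congr Quat; rewrite !(rmorphD, rmorphN, rmorphB, rmorphM) /= !conjCK; ring.
Qed.
Lemma mul1q : left_id (Quat 1 0) mulq.
Proof. by case=> a b; rewrite /mulq /= !mul1r !mul0r subr0 addr0. Qed.
Lemma mulq1 : right_id (Quat 1 0) mulq.
Proof.
by case=> a b; rewrite /mulq /= rmorph0 rmorph1 !mulr0 !mulr1 subr0 add0r.
Qed.
Lemma mulqDl : left_distributive mulq addq.
Proof.
move=> [a b] [c d] [e f]; rewrite /mulq /addq /=.
by congr Quat; ring.
Qed.
Lemma mulqDr : right_distributive mulq addq.
Proof.
move=> [a b] [c d] [e f]; rewrite /mulq /addq /=.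
by congr Quat; rewrite !rmorphD; ring.
Qed.
Lemma oneq_neq0 : Quat 1 0 != 0 :> H.
Proof. by apply/eqP => -[/eqP]; rewrite oner_eq0. Qed.

HB.instance Definition _ :=
  GRing.Zmodule_isNzRing.Build H mulqA mul1q mulq1 mulqDl mulqDr oneq_neq0.

Definition realq (x : R) : H := Quat x%:C 0.
(* (a + b j)^* = a^* - j b^* = a^* - b j *)
Definition conjq x : H := Quat (qa x)^*%R (- qb x).

End QuaternionRing.

Section QuaternionicMatrices.
Variable R : realType.
Local Notation H := (quat R).

Definition adjq m n (M : 'M[H]_(m, n)) : 'M[H]_(n, m) :=
  (map_mx (@conjq R) M)^T.

Definition hyperhermitian n (M : 'M[H]_n) : Prop :=
  forall j k, M j k = conjq (M k j).

Definition qunitary n (E : 'M[H]_n) : Prop :=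
  adjq E *m E = 1%:M /\ E *m adjq E = 1%:M.

Definition tau p m (M : 'M[H]_(p, m)) : 'M[R[i]]_(p + p, m + m) :=
  let a := map_mx (@qa R) M in
  let b := map_mx (@qb R) M in
  block_mx a (- b) (map_mx Num.conj b) (map_mx Num.conj a).

Definition Jmx n : 'M[R[i]]_(n + n) := block_mx 0 1%:M (- 1%:M) 0.

Definition is_moore_det n (M : 'M[H]_n) (d : R) : Prop :=
  exists (E : 'M[H]_n) (nu : 'I_n -> R),
    [/\ qunitary E,
        adjq E *m M *m E = diag_mx (\row_l realq (nu l))
      & d = \prod_l nu l].

(* Junk value 0 if M is not hyperhermitian. *)
Definition moore_det n (M : 'M[H]_n) : R :=
  xget 0 (is_moore_det M : set R).

Definition is_moore_poly n (M : 'I_n -> 'M[H]_n) (p : {mpoly R[n]}) : Prop :=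
  forall lam : 'I_n -> R,
    p.@[lam] = moore_det (\sum_t realq (lam t) *: M t).

Definition moore_poly n (M : 'I_n -> 'M[H]_n) : {mpoly R[n]} :=
  xget 0 (is_moore_poly M : set {mpoly R[n]}).

Definition mixed_discriminant n (M : 'I_n -> 'M[H]_n) : R :=
  (moore_poly M)@_[multinom 1%N | i < n] / (n`!)%:R.

End QuaternionicMatrices.

(* The exterior algebra of the space 'rV[C]_N. An element u is given by    *)
(* its coordinates u S in the basis of the monomials                       *)
(* e_S = e_(i1) /\ ... /\ e_(ik), where S = {i1 < ... < ik} and the e_i    *)
(* are the canonical row vectors.                                          *)
Section ExteriorAlgebra.
Variables (C : numClosedFieldType) (N : nat).

Definition ext : Type := {ffun {set 'I_N} -> C^o}.
HB.instance Definition _ := GRing.Lmodule.on ext.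

Implicit Types (u v : ext) (S T : {set 'I_N}).

Definition inversions S T : nat :=
  #|[set p : 'I_N * 'I_N | [&& p.1 \in S, p.2 \in T & (p.2 < p.1)%N]]|.

(* e_S /\ e_T = (-1)^(inversions S T) e_(S :|: T) if S and T are disjoint, *)
(* and 0 otherwise.                                                        *)
Definition wedge u v : ext :=
  [ffun U : {set 'I_N} => \sum_(S : {set 'I_N} | S \subset U)
     (-1) ^+ inversions S (U :\: S) * u S * v (U :\: S) : C].

Definition ext1 : ext := [ffun S : {set 'I_N} => (S == finset.set0)%:R : C].

Definition ext_vec (x : 'rV[C]_N) : ext :=
  [ffun S : {set 'I_N} => \sum_(A | S == [set A]%SET) x 0 A : C].

(* The extension to the exterior algebra, acting on each factor, of the    *)
(* conjugate-linear map f.                                                 *)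
Definition ext_antilinear (f : 'rV[C]_N -> 'rV[C]_N) u : ext :=
  \sum_(S : {set 'I_N})
    (u S : C)^*%R *: \big[wedge/ext1]_(A <- enum S) ext_vec (f (delta_mx 0 A)).

End ExteriorAlgebra.

(* The basis omega^0, ..., omega^(2n-1) of C^(2n) consists of the rows of  *)
(* the invertible matrix w.                                                *)
Section Triangle.
Variables (R : realType) (n : nat) (w : 'M[R[i]]_(n + n)).
Local Notation C := R[i].
Local Notation Lambda := (ext C (n + n)).

Definition omega (A : 'I_(n + n)) : Lambda := ext_vec (row A w).

Definition Omega2n : Lambda :=
  \big[@wedge C (n + n)/ext1 C (n + n)]_(l < n)
    wedge (omega (lshift n l)) (omega (rshift n l)).

(* x *m invmx w is the row of the coordinates of x in the basis, so this   *)
(* is the conjugate-linear map with                                        *)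
(* z omega^A |-> z^* \sum_B J_AB omega^B.                                  *)
Definition rhoj (x : 'rV[C]_(n + n)) : 'rV[C]_(n + n) :=
  map_mx Num.conj (x *m invmx w) *m Jmx R n *m w.

Definition real_form (u : Lambda) : Prop := ext_antilinear rhoj u = u.

Definition two_form (M : 'M[C]_(n + n)) : Lambda :=
  \sum_A \sum_B M A B *: wedge (omega A) (omega B).

Definition is_triangle (M : 'I_n -> 'M[C]_(n + n)) (c : C) : Prop :=
  (forall t, (M t)^T = - M t /\ real_form (two_form (M t))) /\
  c *: Omega2n = \big[@wedge C (n + n)/ext1 C (n + n)]_(t < n) two_form (M t).

(* Junk value 0 unless all M t are skew-symmetric with a real 2-form. *)
Definition triangle (M : 'I_n -> 'M[C]_(n + n)) : C :=
  xget 0 (is_triangle M : set C).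

End Triangle.

(* Main.v *)
(* Let [Omega] be the top form of the basis [w].  A quaternionic unitary [E]
   satisfies [tau E J (tau E)^T = J], and congruence by [tau E] amounts to a
   change of basis which, as it preserves the 2-form of [J], preserves [Omega],
   since the n-th power of that 2-form is a nonzero multiple of [Omega].
   Diagonalizing a hyperhermitian [M] therefore gives
     (two_form (tau M J))^n = 2^n n! det M *: Omega.
   Apply this to [M = \sum_t lam t M_t] and expand the n-th power: the result is
   a polynomial identity in [lam], where the coefficient of lam_1 ... lam_n is
   n! times the product of the 2-forms of the [M_t], since 2-forms commute.
   Comparing coefficients gives the claim; the imaginary part of that product
   vanishes for the same reason. *)
From HB Require Import structures.
Require Import Defs.
From mathcomp Require Import all_boot all_order all_algebra.
From mathcomp Require Import reals complex.
From mathcomp Require Import ring lra spectral mpoly.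
From mathcomp Require boolp classical_sets.

Set Implicit Arguments.
Unset Strict Implicit.
Unset Printing Implicit Defensive.

Import Order.TTheory GRing.Theory Num.Theory.
Local Open Scope ring_scope.
Local Open Scope complex_scope.

(** * The exterior algebra *)

Section ExteriorRing.
Variables (C : numClosedFieldType) (N : nat).
Local Notation ext := (ext C N).
Implicit Types (u v : ext) (S T U : {set 'I_N}).

Lemma inversionsE S T :
  inversions S T = (\sum_(i in S) \sum_(j in T) (j < i)%N)%N.
Proof.
rewrite pair_big_dep /= /inversions -sum1dep_card.
rewrite [RHS](bigID (fun p : 'I_N * 'I_N => p.2 < p.1)%N) /=.
rewrite [X in (_ + X)%N]big1 ?addn0; last by move=> [i j] /andP[_ /negbTE ->].
rewrite [LHS](eq_bigl (fun p : 'I_N * 'I_N =>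
  ((p.1 \in S) && (p.2 \in T)) && (p.2 < p.1)%N)); last first.
  by move=> p; rewrite andbA.
by apply: eq_bigr => -[i j] /andP[_ ->].
Qed.

Lemma sum_setU S T (F : 'I_N -> nat) : [disjoint S & T] ->
  (\sum_(i in S :|: T) F i = \sum_(i in S) F i + \sum_(i in T) F i)%N.
Proof. by move=> dST; rewrite -bigU //; apply: eq_bigl => i; rewrite !inE. Qed.

Lemma subset_setDK S T : S \subset T -> S :|: (T :\: S) = T.
Proof. by move=> /setIidPr {1}<-; rewrite setID. Qed.

Lemma disjoint_setUDl S T : [disjoint S & T] -> (S :|: T) :\: S = T.
Proof.
by move=> dST; rewrite setDUl setDv set0U; apply/setDidPl; rewrite disjoint_sym.
Qed.

Lemma inversionsUl S T U : [disjoint S & T] ->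
  inversions (S :|: T) U = (inversions S U + inversions T U)%N.
Proof. by move=> dST; rewrite !inversionsE sum_setU. Qed.

Lemma inversionsUr S T U : [disjoint T & U] ->
  inversions S (T :|: U) = (inversions S T + inversions S U)%N.
Proof.
move=> dTU; rewrite !inversionsE -big_split /=.
by apply: eq_bigr => i _; rewrite sum_setU.
Qed.

Lemma wedgeE u v U : wedge u v U =
  \sum_(S : {set 'I_N} | S \subset U)
     (-1) ^+ inversions S (U :\: S) * u S * v (U :\: S).
Proof. by rewrite ffunE. Qed.

(** Both sides are sums over the splittings of [U] into three disjoint blocks. The right-hand sum is
    reindexed by [T] becoming [S :|: T], and the signs match because [inversions] is additive in
    each argument over disjoint unions. *)
Lemma wedgeA : associative (@wedge C N).
Proof.
move=> u v w; apply/ffunP => U; rewrite !wedgeE.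
under eq_bigr => S SU do rewrite wedgeE mulr_sumr.
under [RHS]eq_bigr => S SU do rewrite wedgeE mulr_sumr mulr_suml.
rewrite [RHS](exchange_big_dep (fun S => S \subset U)) /=; last first.
  by move=> S T SU /subset_trans; apply.
apply: eq_bigr => S SU.
rewrite [RHS](reindex_onto (fun T => S :|: T) (fun T => T :\: S)) /=; last first.
  by move=> T /andP[_ ST]; rewrite subset_setDK.
apply: eq_big => [T|T TU].
  rewrite subsetD subUset SU subsetUl /= andbT; congr (_ && _).
  apply/idP/eqP => [dTS|<-]; first by rewrite disjoint_setUDl // disjoint_sym.
  by rewrite disjoint_sym -setI_eq0 setIDA setIC -setIDA setDv setI0.
have TUS := TU; move: TU; rewrite subsetD disjoint_sym => /andP[TU dST].
rewrite disjoint_setUDl // -setDDl.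
have dT : [disjoint T & U :\: S :\: T].
  by rewrite -setI_eq0 setIDA setIC -setIDA setDv setI0.
rewrite -{1}(subset_setDK TUS) inversionsUr // inversionsUl //.
rewrite !exprD; ring.
Qed.

Lemma inversions0l S : inversions set0 S = 0%N.
Proof. by rewrite inversionsE big_set0. Qed.

Lemma inversions0r S : inversions S set0 = 0%N.
Proof. by rewrite inversionsE big1 // => i _; rewrite big_set0. Qed.

Lemma wedge1l : left_id (ext1 C N) (@wedge C N).
Proof.
move=> u; apply/ffunP => U; rewrite wedgeE (bigD1 set0) ?sub0set //=.
rewrite big1 => [|S /andP[_ /negbTE S0]]; last by rewrite ffunE S0 mulr0 mul0r.
by rewrite ffunE eqxx inversions0l setD0 !mul1r addr0.
Qed.

Lemma wedge1r : right_id (ext1 C N) (@wedge C N).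
Proof.
move=> u; apply/ffunP => U; rewrite wedgeE (bigD1 U) //=.
rewrite big1 => [|S /andP[SU nSU]]; last first.
  rewrite ffunE setD_eq0; have -> : (U \subset S) = false.
    by apply: contraNF nSU => US; rewrite eqEsubset SU.
  by rewrite mulr0.
by rewrite ffunE setDv eqxx inversions0r mul1r mulr1 addr0.
Qed.

Lemma wedgeDl : left_distributive (@wedge C N) +%R.
Proof.
move=> u v w; apply/ffunP => U; rewrite [RHS]ffunE !wedgeE -big_split /=.
by apply: eq_bigr => S _; rewrite ffunE mulrDr mulrDl.
Qed.

Lemma wedgeDr : right_distributive (@wedge C N) +%R.
Proof.
move=> u v w; apply/ffunP => U; rewrite [RHS]ffunE !wedgeE -big_split /=.
by apply: eq_bigr => S _; rewrite ffunE mulrDr.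
Qed.

Lemma ext1_neq0 : ext1 C N != 0.
Proof.
apply/eqP => /ffunP /(_ set0); rewrite !ffunE eqxx => /eqP.
by rewrite oner_eq0.
Qed.

HB.instance Definition _ := GRing.Zmodule_isNzRing.Build ext
  wedgeA wedge1l wedge1r wedgeDl wedgeDr ext1_neq0.

Lemma wedgeZl (a : C) u v : a *: (u * v) = (a *: u) * v.
Proof.
apply/ffunP => U; rewrite ffunE !wedgeE scaler_sumr.
by apply: eq_bigr => S _; rewrite ffunE /GRing.scale /=; ring.
Qed.

Lemma wedgeZr (a : C) u v : a *: (u * v) = u * (a *: v).
Proof.
apply/ffunP => U; rewrite ffunE !wedgeE scaler_sumr.
by apply: eq_bigr => S _; rewrite ffunE /GRing.scale /=; ring.
Qed.

HB.instance Definition _ := GRing.Lmodule_isLalgebra.Build C ext wedgeZl.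
HB.instance Definition _ := GRing.Lalgebra_isAlgebra.Build C ext wedgeZr.

End ExteriorRing.

(** * Products of families that commute up to a fixed sign *)

Section EpsilonCommute.
Variables (K : comNzRingType) (A : algType K) (I : eqType).
Variables (eps : K) (x : I -> A).
Hypothesis eps2 : eps * eps = 1.
Hypothesis xC : forall i j, x i * x j = eps *: (x j * x i).
Implicit Types s t : seq I.

Lemma prod_move s t i : exists k, \prod_(j <- s ++ i :: t) x j =
  eps ^+ k *: (x i * \prod_(j <- s ++ t) x j).
Proof.
elim: s => [|j s [k IH]] /=; first by exists 0%N; rewrite big_cons scale1r.
exists k.+1; rewrite !big_cons IH -scalerAr (mulrA (x j)) (xC j i) -scalerAl -mulrA.
by rewrite scalerA -exprSr.
Qed.

(** Each swap of neighbours costs a factor [eps]. The case [eps = 1] serves commuting 2-forms and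
    [eps = -1] serves vectors; the exponent can stay unspecified in both uses. *)
Lemma prod_perm_eps s t : perm_eq s t -> exists k,
  \prod_(i <- s) x i = eps ^+ k *: \prod_(i <- t) x i.
Proof.
elim: s t => [t|i s IH t] st.
  by exists 0%N; move: st; rewrite perm_sym => /perm_nilP ->; rewrite scale1r.
have it : i \in t by rewrite -(perm_mem st) mem_head.
case: (splitPr it) st => t1 t2 st.
have := perm_trans st (permEl (perm_catCA t1 [:: i] t2)).
rewrite /= perm_cons => /IH [k stk].
have [l xl] := prod_move t1 t2 i.
have epsK m : eps ^+ m * eps ^+ m = 1 by rewrite -exprMn eps2 expr1n.
(* Extracting [i] from the middle of the target list costs [eps ^+ l]; since [eps] squares to 1, a
   second such factor cancels it. *)
exists (k + l)%N; rewrite big_cons stk xl scalerA exprD -mulrA epsK mulr1.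
by rewrite -scalerAr.
Qed.

(** A repeated index can be moved next to its other occurrence, where the square vanishes. *)
Lemma prod_nonuniq s : (forall i, x i * x i = 0) -> ~~ uniq s ->
  \prod_(i <- s) x i = 0.
Proof.
move=> x2; elim: s => //= i s IH; rewrite negb_and negbK big_cons.
case/orP => [si|/IH ->]; last by rewrite mulr0.
have [k ->] := prod_perm_eps (perm_to_rem si).
by rewrite big_cons -scalerAr mulrA x2 mul0r scaler0.
Qed.

End EpsilonCommute.

Section CommutingFamily.
Variables (K : comNzRingType) (A : algType K) (n : nat) (x : 'I_n -> A).
Hypothesis xC : forall i j, x i * x j = x j * x i.

Lemma prod_inj_comm (f : 'I_n -> 'I_n) : injective f ->
  \prod_(i < n) x (f i) = \prod_(i < n) x i.
Proof.
move=> fI.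
have xC1 i j : x i * x j = 1 *: (x j * x i) by rewrite scale1r.
have pf : perm_eq [seq f i | i <- index_enum 'I_n] (index_enum 'I_n).
  apply: uniq_perm => [||i].
  - by rewrite (map_inj_uniq fI) index_enum_uniq.
  - exact: index_enum_uniq.
  rewrite mem_index_enum; apply/mapP.
  by exists (invF fI i); rewrite ?f_invF ?mem_index_enum.
have [k] := prod_perm_eps (mulr1 1) xC1 pf.
by rewrite big_map expr1n scale1r.
Qed.

Lemma prod_noninj_comm (f : 'I_n -> 'I_n) :
  (forall i, x i * x i = 0) -> ~~ injectiveb f -> \prod_(i < n) x (f i) = 0.
Proof.
move=> x2 fNI.
have xC1 i j : x i * x j = 1 *: (x j * x i) by rewrite scale1r.
rewrite -(big_map f predT x); apply: (prod_nonuniq (mulr1 1) xC1) => //.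
by apply: contra fNI; rewrite /injectiveb /dinjectiveb enumT [index_enum _]unlock.

Qed.

Lemma card_injective_ffun : #|[pred f : {ffun 'I_n -> 'I_n} | injectiveb f]| = n`!.
Proof.
have := card_inj_ffuns 'I_n 'I_n; rewrite card_ord ffactnn => <-.
by rewrite cardsE.
Qed.

(** Expand over all index maps: a non-injective one repeats a factor and contributes 0, and each of
    the [n!] injective ones contributes the same reordered product. *)
Lemma prod_sum_comm (c : 'I_n -> K) :  (forall i, x i * x i = 0) ->
  \prod_(i < n) (\sum_j c j *: x j) =
  ((n`!)%:R * \prod_i c i) *: \prod_(i < n) x i.
Proof.
move=> x2; rewrite bigA_distr_bigA /=.
rewrite (bigID (fun f : {ffun _} => injectiveb f)) /=.
rewrite [X in _ + X]big1 ?addr0 => [|f fNI]; last first.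
  by rewrite scaler_prod prod_noninj_comm ?scaler0.
rewrite (eq_bigr (fun=> (\prod_i c i) *: \prod_(i < n) x i)) => [|f /injectiveP fI].
  by rewrite sumr_const card_injective_ffun -scaler_nat scalerA.
rewrite scaler_prod prod_inj_comm //; congr (_ *: _).
by rewrite [RHS](reindex_inj fI).
Qed.
End CommutingFamily.

(** * Vectors, basis monomials and degree *)

Section ExteriorVectors.
Variables (C : numClosedFieldType) (N : nat).
Local Notation ext := (ext C N).
Implicit Types (u v : ext) (S T U : {set 'I_N}) (x y : 'rV[C]_N).

Definition ext_basis S : ext := [ffun T => (T == S)%:R : C].

Lemma ext_vec_sum x : ext_vec x = \sum_A x 0 A *: ext_basis [set A].
Proof.
apply/ffunP => S; rewrite sum_ffunE !ffunE big_mkcond /=.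
apply: eq_bigr => A _; rewrite !ffunE /GRing.scale /=.
by case: eqP; rewrite ?mulr1 ?mulr0.
Qed.

Lemma ext_vec_delta A : ext_vec (delta_mx 0 A) = ext_basis [set A].
Proof.
rewrite ext_vec_sum (bigD1 A) //= big1 => [|B /negbTE BA].
  by rewrite mxE !eqxx scale1r addr0.
by rewrite mxE BA andbF scale0r.
Qed.

Lemma ext_vec_is_linear : linear (@ext_vec C N).
Proof.
move=> a x y; rewrite !ext_vec_sum scaler_sumr -big_split /=.
by apply: eq_bigr => A _; rewrite !mxE scalerDl scalerA.
Qed.
HB.instance Definition _ := GRing.isLinear.Build C 'rV[C]_N ext *:%R
  (@ext_vec C N) ext_vec_is_linear.

Lemma ext_vec_mulmx m (X : 'M[C]_(m, N)) (w : 'M[C]_N) i :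
  ext_vec (row i (X *m w)) = \sum_B X i B *: ext_vec (row B w).
Proof.
rewrite row_mul mulmx_sum_row linear_sum /=.
by apply: eq_bigr => B _; rewrite linearZ /= mxE.
Qed.

Lemma ext_basisM S T : ext_basis S * ext_basis T =
  if [disjoint S & T] then (-1) ^+ inversions S T *: ext_basis (S :|: T) else 0.
Proof.
apply/ffunP => U; rewrite wedgeE.
transitivity (if [disjoint S & T] && (U == S :|: T)
  then (-1) ^+ inversions S T else 0 : C); last first.
  case: ifP => [/andP[-> /eqP ->]|].
    by rewrite !ffunE eqxx /GRing.scale /= mulr1.
  by case: ifP => _ /= UN; rewrite !ffunE // UN scaler0.
case: ifP => [/andP[dST /eqP ->]|UN].
  rewrite (bigD1 S) ?subsetUl //= big1 => [|S' /andP[_ /negbTE S'S]].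
    by rewrite disjoint_setUDl // !ffunE !eqxx !mulr1 addr0.
  by rewrite ffunE S'S mulr0 mul0r.
rewrite big1 // => S' S'U; rewrite !ffunE.
have [S'S|] := eqVneq S' S; last by rewrite mulr0 mul0r.
have [UST|] := eqVneq; last by rewrite mulr0.
move: UN; rewrite -UST -S'S subset_setDK // eqxx andbT => /negP[].
by rewrite -setI_eq0 setIDA setIC -setIDA setDv setI0.
Qed.

Lemma ext_basis1_anticomm (A B : 'I_N) :
  ext_basis [set A] * ext_basis [set B] =
  - (ext_basis [set B] * ext_basis [set A]).
Proof.
rewrite !ext_basisM !disjoints1 !inE eq_sym.
have [_|AB] := eqVneq A B; first by rewrite oppr0.
rewrite setUC -scaleNr !inversionsE !big_set1.
have : (A < B)%N || (B < A)%N by rewrite -neq_ltn.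
by case: ltngtP => //= _ _; rewrite !expr1 !expr0 ?opprK.
Qed.

Lemma ext_vec_anticomm x y : ext_vec x * ext_vec y = - (ext_vec y * ext_vec x).
Proof.
rewrite !ext_vec_sum !mulr_suml -sumrN.
under eq_bigr do rewrite mulr_sumr.
under [RHS]eq_bigr do rewrite mulr_sumr -sumrN.
rewrite exchange_big /=; apply: eq_bigr => A _; apply: eq_bigr => B _.
rewrite -!scalerAl -!scalerAr ext_basis1_anticomm !scalerN !scalerA.
by rewrite [_ * x _ _]mulrC.
Qed.

Lemma ext_vec_sqr x : ext_vec x * ext_vec x = 0.
Proof.
apply/eqP; have /eqP := ext_vec_anticomm x x; rewrite -addr_eq0 -mulr2n.
by rewrite -scaler_nat scaler_eq0 pnatr_eq0.
Qed.

(** Phrased through the support, so that 0 is homogeneous of every degree. *)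
Definition homogeneous k u := forall S, u S != 0 -> #|S| = k.

Lemma homogeneous_vec x : homogeneous 1 (ext_vec x).
Proof.
move=> S; rewrite ffunE; case: (pickP (fun A => S == [set A])) => [A /eqP ->|S0].
  by rewrite cards1.
by rewrite big_pred0 ?eqxx.
Qed.

Lemma homogeneousM k l u v :
  homogeneous k u -> homogeneous l v -> homogeneous (k + l) (u * v).
Proof.
move=> hu hv U; rewrite wedgeE => U0.
have [S /andP[SU]|all0] := pickP (fun S =>
  (S \subset U) && (u S * v (U :\: S) != 0)).
  rewrite mulf_eq0 negb_or => /andP[/hu <- /hv <-].
  by rewrite -(cardsID S U) (setIidPr SU).
case/eqP: U0; rewrite big1 // => S SU; move: (all0 S); rewrite SU /=.
by move=> /negbFE/eqP; rewrite -mulrA => ->; rewrite mulr0.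
Qed.

Lemma homogeneous_sum k (I : finType) (F : I -> ext) :
  (forall i, homogeneous k (F i)) -> homogeneous k (\sum_i F i).
Proof.
move=> hF S; rewrite sum_ffunE => S0.
have [i /hF //|all0] := pickP (fun i => F i S != 0).
by case/eqP: S0; rewrite big1 // => i _; move/negbFE/eqP: (all0 i).
Qed.

Lemma homogeneous_prod k m (F : 'I_m -> ext) :
  (forall i, homogeneous k (F i)) -> homogeneous (m * k) (\prod_(i < m) F i).
Proof.
elim: m F => [|m IH] F hF.
  move=> S; rewrite big_ord0 mul0n ffunE; have [->|_] := eqVneq S set0.
    by rewrite cards0.
  by rewrite eqxx.
by rewrite big_ord_recl mulSn; apply: homogeneousM => //; apply: IH.
Qed.

(** The full set is the only subset with [N] elements, so the top degree is a line. *)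
Lemma homogeneous_top u : homogeneous N u -> u = u setT *: ext_basis setT.
Proof.
move=> hu; apply/ffunP => S; rewrite !ffunE /GRing.scale /=.
have [->|ST] := eqVneq S setT; first by rewrite mulr1.
rewrite mulr0; apply/eqP; apply: contraNT ST => /hu cS.
by rewrite eqEcard subsetT cardsT card_ord cS leqnn.
Qed.

Lemma prod_ext_basis (s : seq 'I_N) : uniq s -> exists k,
  \prod_(A <- s) ext_basis [set A] = (-1) ^+ k *: ext_basis [set A in s].
Proof.
elim: s => [_|A s IH /= /andP[As /IH[k sk]]].
  exists 0%N; rewrite big_nil scale1r; apply/ffunP => S; rewrite !ffunE.
  by congr (_ == _)%:R; apply/setP => A; rewrite !inE.
exists (k + inversions [set A] [set B in s])%N.
rewrite big_cons sk -scalerAr ext_basisM disjoints1 !inE As scalerA -exprD.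
by congr (_ *: ext_basis _); apply/setP => B; rewrite !inE.
Qed.

(* Otherwise every product of [N] rows of [w] vanishes; expressing the canonical
   basis in the rows of [w], so does the top monomial. *)
Lemma prod_rows_neq0 (w : 'M[C]_N) (s : seq 'I_N) : w \in unitmx ->
  uniq s -> size s = N -> \prod_(A <- s) ext_vec (row A w) != 0.
Proof.
move=> wU sU sN; apply/eqP => s0.
pose x A := ext_vec (row A w).
have xC A B : x A * x B = (-1) *: (x B * x A).
  by rewrite scaleN1r; apply: ext_vec_anticomm.
have eps2 : (-1) * (-1) = 1 :> C by rewrite mulrNN mulr1.
have mem_full (t : seq 'I_N) : uniq t -> size t = N -> t =i 'I_N.
  move=> tU tN A; apply/esym; rewrite inE; apply/idP/idP => // _.
  have /uniq_min_size : {subset t <= enum 'I_N} by move=> B; rewrite mem_enum.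
  by move=> /(_ tU) []; rewrite ?size_enum_ord ?tN // => _ ->; rewrite mem_enum.
have t0 (t : seq 'I_N) : size t = N -> \prod_(A <- t) x A = 0.
  move=> tN; have [tU|] := boolP (uniq t); last first.
    by apply: (prod_nonuniq eps2 xC) => A; apply: ext_vec_sqr.
  have /(prod_perm_eps eps2 xC) [k ->] : perm_eq t s.
    by apply: uniq_perm => // A; rewrite !mem_full.
  by rewrite s0 scaler0.
have e0 (r t : seq 'I_N) : (size r + size t = N)%N ->
    \prod_(A <- t) x A * \prod_(A <- r) ext_basis [set A] = 0.
  elim: r t => [|A r IH] t /= rt; first by rewrite big_nil mulr1 t0.
  rewrite big_cons mulrA -ext_vec_delta -row1 -(mulVmx wU) ext_vec_mulmx.
  rewrite mulr_sumr mulr_suml big1 // => B _.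
  have := IH (rcons t B).
  rewrite size_rcons -addSnnS => /(_ rt).
  by rewrite -cats1 big_cat big_seq1 -scalerAr -scalerAl => ->; rewrite scaler0.
have := e0 (enum 'I_N) [::]; rewrite big_nil mul1r size_enum_ord addn0.
have [k ->] := prod_ext_basis (enum_uniq 'I_N).
move=> /(_ erefl) /ffunP /(_ [set B in enum 'I_N]) /eqP.
by rewrite !ffunE eqxx /GRing.scale /= mulr1 signr_eq0.
Qed.

End ExteriorVectors.

(** * The embedding tau and 2-forms *)

Lemma congr_block_mx (K : Type) m1 m2 n1 n2
  (A A' : 'M[K]_(m1, n1)) (B B' : 'M[K]_(m1, n2))
  (D D' : 'M[K]_(m2, n1)) (E E' : 'M[K]_(m2, n2)) :
  A = A' -> B = B' -> D = D' -> E = E' ->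
  block_mx A B D E = block_mx A' B' D' E'.
Proof. by move=> -> -> -> ->. Qed.

Section QuaternionicTau.
Variable R : realType.
Local Notation H := (quat R).
Local Notation C := R[i].

Fact qa_is_zmod : zmod_morphism (@qa R). Proof. by []. Qed.
HB.instance Definition _ := GRing.isZmodMorphism.Build H C (@qa R) qa_is_zmod.
Fact qb_is_zmod : zmod_morphism (@qb R). Proof. by []. Qed.
HB.instance Definition _ := GRing.isZmodMorphism.Build H C (@qb R) qb_is_zmod.
Fact conjq_is_zmod : zmod_morphism (@conjq R).
Proof. by move=> x y; rewrite /conjq rmorphB opprD. Qed.
HB.instance Definition _ := GRing.isZmodMorphism.Build H H (@conjq R) conjq_is_zmod.

Lemma quatP (x y : H) : qa x = qa y -> qb x = qb y -> x = y.
Proof. by case: x y => [a b] [c d] /= -> ->. Qed.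

Lemma qaM (x y : H) : qa (x * y) = qa x * qa y - qb x * (qb y)^*%R.
Proof. by []. Qed.

Lemma qbM (x y : H) : qb (x * y) = qa x * qb y + qb x * (qa y)^*%R.
Proof. by []. Qed.

Lemma conjqM (x y : H) : conjq (x * y) = conjq y * conjq x.
Proof.
by apply: quatP; rewrite /= ?(qaM, qbM) /= ?(rmorphB, rmorphM, rmorphN) /= ?conjCK;
  ring.
Qed.

Lemma conjqK : involutive (@conjq R).
Proof. by move=> x; apply: quatP; rewrite /= ?conjCK ?opprK. Qed.

Lemma adjqM m n p (A : 'M[H]_(m, n)) (B : 'M[H]_(n, p)) :
  adjq (A *m B) = adjq B *m adjq A.
Proof.
apply/matrixP => i j; rewrite !mxE raddf_sum.
by apply: eq_bigr => k _; rewrite !mxE /= conjqM.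
Qed.

Lemma adjqK m n (A : 'M[H]_(m, n)) : adjq (adjq A) = A.
Proof. by apply/matrixP => i j; rewrite !mxE conjqK. Qed.

Lemma hyperhermitianP n (M : 'M[H]_n) : hyperhermitian M <-> adjq M = M.
Proof.
split=> [hM|hM j k]; first by apply/matrixP => i j; rewrite !mxE -hM.
by rewrite -[in LHS]hM !mxE.
Qed.

Lemma tauM m n p (A : 'M[H]_(m, n)) (B : 'M[H]_(n, p)) :
  tau (A *m B) = tau A *m tau B.
Proof.
have mx_qaM : map_mx (@qa R) (A *m B) = map_mx (@qa R) A *m map_mx (@qa R) B
    - map_mx (@qb R) A *m map_mx Num.conj (map_mx (@qb R) B).
  apply/matrixP => i j; rewrite !mxE raddf_sum -sumrB.
  by apply: eq_bigr => k _; rewrite !mxE.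
have mx_qbM : map_mx (@qb R) (A *m B) = map_mx (@qa R) A *m map_mx (@qb R) B
    + map_mx (@qb R) A *m map_mx Num.conj (map_mx (@qa R) B).
  apply/matrixP => i j; rewrite !mxE raddf_sum -big_split.
  by apply: eq_bigr => k _; rewrite !mxE.
have conjK m1 n1 (X : 'M[C]_(m1, n1)) : map_mx Num.conj (map_mx Num.conj X) = X.
  by apply/matrixP => i j; rewrite !mxE conjCK.
have cM m1 n1 p1 (X : 'M[C]_(m1, n1)) (Y : 'M[C]_(n1, p1)) :
    map_mx Num.conj (X *m Y) = map_mx Num.conj X *m map_mx Num.conj Y.
  exact: map_mxM.
have cD m1 n1 (X Y : 'M[C]_(m1, n1)) :
    map_mx Num.conj (X + Y) = map_mx Num.conj X + map_mx Num.conj Y.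
  exact: map_mxD.
have cN m1 n1 (X : 'M[C]_(m1, n1)) : map_mx Num.conj (- X) = - map_mx Num.conj X.
  exact: map_mxN.
rewrite /tau mulmx_block mx_qaM mx_qbM !mulNmx !mulmxN !(cD, cN, cM, conjK).
apply: congr_block_mx.
- exact: erefl.
- exact: opprD.
- exact: addrC.
- exact: addrC.
Qed.

Lemma tau1 n : tau (1%:M : 'M[H]_n) = 1%:M.
Proof.
rewrite /tau [RHS]scalar_mx_block.
apply: congr_block_mx; apply/matrixP => i j; rewrite !mxE;
  by case: (i == j); rewrite ?mulr1n ?mulr0n /= ?oppr0 ?rmorph0 ?rmorph1.
Qed.

Lemma tau_adjq m n (A : 'M[H]_(m, n)) :
  tau (adjq A) = map_mx Num.conj (tau A)^T.
Proof.
rewrite /tau tr_block_mx map_block_mx; apply: congr_block_mx; apply/matrixP => i j;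
  by rewrite !mxE /= ?rmorphN ?conjCK ?opprK.
Qed.

(** Equivalently, [tau A] commutes with the conjugate-linear map sending v to J times the conjugate
    of v. Skew-symmetry, symplecticity and reality below all rest on this. *)
Lemma tau_Jmx n (A : 'M[H]_n) :
  tau A *m Jmx R n = Jmx R n *m map_mx Num.conj (tau A).
Proof.
rewrite /tau /Jmx map_block_mx !mulmx_block.
rewrite !mulmx0 !mul0mx !mulmxN !mulNmx !mulmx1 !mul1mx !add0r !addr0.
by apply: congr_block_mx; apply/matrixP => i j;
  rewrite !mxE /= ?rmorphN /= ?conjCK ?opprK.
Qed.

Lemma Jmx_tr n : (Jmx R n)^T = - Jmx R n.
Proof.
by rewrite /Jmx tr_block_mx opp_block_mx !trmx0 oppr0 opprK linearN /= trmx1.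
Qed.

Lemma Jmx_sqr n : Jmx R n *m Jmx R n = - 1%:M.
Proof.
rewrite /Jmx mulmx_block !mulmx0 !mul0mx !mulmx1 !mul1mx !add0r !addr0.
by rewrite scalar_mx_block opp_block_mx oppr0.
Qed.

(** Moving past J conjugates the entries, which turns the conjugate transpose of [tau_adjq] into a
    plain transpose. *)
Lemma tau_adjq_Jmx n (A : 'M[H]_n) :
  tau (adjq A) *m Jmx R n = Jmx R n *m (tau A)^T.
Proof.
rewrite tau_Jmx tau_adjq; congr (_ *m _).
by apply/matrixP => i j; rewrite !mxE conjCK.
Qed.

Lemma tau_skew n (A : 'M[H]_n) : hyperhermitian A ->
  (tau A *m Jmx R n)^T = - (tau A *m Jmx R n).
Proof.
move=> /hyperhermitianP hA.
by rewrite trmx_mul Jmx_tr mulNmx -tau_adjq_Jmx hA.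
Qed.

Lemma tau_unitary n (E : 'M[H]_n) : qunitary E ->
  tau E *m Jmx R n *m (tau E)^T = Jmx R n.
Proof.
by case=> _ EE; rewrite -mulmxA -tau_adjq_Jmx mulmxA -tauM EE tau1 mul1mx.
Qed.

Lemma conj_real_complex (a : R) : (a%:C)^*%R = a%:C.
Proof. exact: conjc_real. Qed.

Lemma tau_diag n (nu : 'I_n -> R) :
  tau (diag_mx (\row_l realq (nu l))) *m Jmx R n =
  block_mx 0 (diag_mx (\row_l (nu l)%:C)) (- diag_mx (\row_l (nu l)%:C)) 0.
Proof.
rewrite /tau /Jmx mulmx_block.
rewrite !mulmx0 !mulmxN !mulNmx !mulmx1 !add0r !addr0.
apply: congr_block_mx; apply/matrixP => i j; rewrite !mxE;
  case: (i == j); rewrite ?mulr1n ?mulr0n /= ?oppr0 ?rmorph0 //.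
- by rewrite conj_real_complex.
- by rewrite ?oppr0.
Qed.

End QuaternionicTau.

(** * 2-forms, their products and the top form *)

Section TwoForms.
Variables (R : realType) (n : nat).
Local Notation C := R[i].
Implicit Types (w K T : 'M[C]_(n + n)).
Local Notation form := (ext C (n + n)).

(** Absorbing the inner sum into a vector turns linearity in [K] and changes of basis into matrix
    algebra. *)
Lemma two_formE w K : two_form w K =
  \sum_A ext_vec (row A w) * ext_vec (row A (K *m w)).
Proof.
apply: eq_bigr => A _; rewrite ext_vec_mulmx mulr_sumr.
by apply: eq_bigr => B _; rewrite -scalerAr.
Qed.

Lemma two_form_congr w K T : two_form (T *m w) K = two_form w (T^T *m K *m T).
Proof.
rewrite !two_formE.
under eq_bigr do rewrite ext_vec_mulmx mulr_suml.
rewrite exchange_big /=; apply: eq_bigr => B _.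
rewrite -!mulmxA ext_vec_mulmx mulr_sumr.
by apply: eq_bigr => A _; rewrite -scalerAl -scalerAr !mxE.
Qed.

Lemma two_form_is_linear w : linear (two_form w).
Proof.
move=> a K L; rewrite !two_formE scaler_sumr -big_split /=.
apply: eq_bigr => A _.
by rewrite mulmxDl -scalemxAl !linearP /= mulrDr -scalerAr.
Qed.
HB.instance Definition _ w := GRing.isLinear.Build C 'M[C]_(n + n) form *:%R
  (two_form w) (two_form_is_linear w).

Lemma homogeneous_two_form w K : homogeneous 2 (two_form w K).
Proof.
rewrite two_formE; apply: homogeneous_sum => A.
by apply: (@homogeneousM _ _ 1 1); apply: homogeneous_vec.
Qed.

(** Exchanging the two pairs takes four transpositions of vectors, so the signs cancel. *)
Lemma ext_vec_pairC (x y z t : 'rV[C]_(n + n)) :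
  (ext_vec x * ext_vec y) * (ext_vec z * ext_vec t) =
  (ext_vec z * ext_vec t) * (ext_vec x * ext_vec y) :> form.
Proof.
have swap a b (u : form) :
    ext_vec a * (ext_vec b * u) = - (ext_vec b * (ext_vec a * u)).
  by rewrite mulrA ext_vec_anticomm mulNr mulrA.
rewrite -!mulrA (swap y z) mulrN (swap x z) opprK (ext_vec_anticomm y t) !mulrN.
by rewrite (swap x t) mulrN opprK.
Qed.

Lemma two_formC w K L : two_form w K * two_form w L = two_form w L * two_form w K.
Proof.
rewrite !two_formE !mulr_suml.
under eq_bigr do rewrite mulr_sumr.
under [RHS]eq_bigr do rewrite mulr_sumr.
rewrite exchange_big /=; apply: eq_bigr => A _; apply: eq_bigr => B _.
exact: ext_vec_pairC.
Qed.

Definition plane_form w l : form := omega w (lshift n l) * omega w (rshift n l).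

Lemma plane_formC w l m : plane_form w l * plane_form w m =
  plane_form w m * plane_form w l.
Proof. exact: ext_vec_pairC. Qed.

Lemma plane_form_sqr w l : plane_form w l * plane_form w l = 0.
Proof.
have yx := ext_vec_anticomm (row (rshift n l) w) (row (lshift n l) w).
rewrite /plane_form -mulrA (mulrA (omega w (rshift n l))) yx mulNr -mulrA.
by rewrite ext_vec_sqr mulr0 oppr0 mulr0.
Qed.

Lemma Omega2nE w : Omega2n w = \prod_(l < n) plane_form w l.
Proof. by []. Qed.

Lemma Omega2n_neq0 w : w \in unitmx -> Omega2n w != 0.
Proof.
move=> wU.
(* The factors of [Omega2n] in their interleaved order. *)
pose s := flatten [seq [:: lshift n l; rshift n l] | l <- index_enum 'I_n].
have -> : Omega2n w = \prod_(A <- s) ext_vec (row A w).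
  rewrite Omega2nE big_flatten big_map; apply: eq_bigr => l _.
  by rewrite !big_cons big_nil /= mulr1.
have ss : size s = (n + n)%N.
  rewrite size_flatten /shape -map_comp sumnE big_map /= sum_nat_const card_ord.
  by rewrite muln2 addnn.
apply: prod_rows_neq0 => //.
(* A list of length 2n that contains all 2n indices has no repetition. *)
apply: (@leq_size_uniq _ (enum 'I_(n + n))); rewrite ?enum_uniq //; last first.
  by rewrite ss size_enum_ord.
move=> A _; apply/flattenP; case: (split_ordP A) => l ->;
  exists [:: lshift n l; rshift n l]; rewrite ?inE ?eqxx ?orbT //;
  by apply/mapP; exists l; rewrite ?mem_index_enum.
Qed.

(** Both forms have top degree, so each is determined by its coefficient at the full set; that of
    [Omega2n w] is nonzero and [c] is the quotient. *)
Lemma prod_two_form_Omega2n w (K : 'I_n -> 'M[C]_(n + n)) : w \in unitmx ->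
  exists c, \prod_(t < n) two_form w (K t) = c *: Omega2n w.
Proof.
move=> wU.
have n2 : (n * 2)%N = (n + n)%N by rewrite muln2 addnn.
have h1 : homogeneous (n + n) (\prod_(t < n) two_form w (K t)).
  rewrite -[X in homogeneous X]n2; apply: homogeneous_prod => t.
  exact: homogeneous_two_form.
have h2 : homogeneous (n + n) (Omega2n w).
  rewrite -[X in homogeneous X]n2; apply: homogeneous_prod => t.
  by apply: (@homogeneousM _ _ 1 1); apply: homogeneous_vec.
have O0 := Omega2n_neq0 wU.
pose b : C := Omega2n w setT; pose a : C := (\prod_(t < n) two_form w (K t)) setT.
have b0 : b != 0.
  by apply: contraNneq O0 => b0; rewrite (homogeneous_top h2) -/b b0 scale0r.
exists (a / b); rewrite [LHS](homogeneous_top h1) [in RHS](homogeneous_top h2).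
by rewrite scalerA -/a -/b divfK.
Qed.

(** The factor 2 arises because each plane is met twice, as (l, n+l) with entry d and as (n+l, l)
    with entry -d, and the wedge is antisymmetric. *)
Lemma two_form_diag w (d : 'rV[C]_n) :
  two_form w (block_mx 0 (diag_mx d) (- diag_mx d) 0) =
  \sum_l (2 * d 0 l) *: plane_form w l.
Proof.
rewrite two_formE big_split_ord /= -big_split /=; apply: eq_bigr => l _.
have rowD (v : 'M[C]_(n, n + n)) : row l (diag_mx d *m v) = d 0 l *: row l v.
  by rewrite row_mul row_diag_mx -scalemxAl -rowE.
have rowL : row (lshift n l) (block_mx 0 (diag_mx d) (- diag_mx d) 0 *m w) =
    d 0 l *: row (rshift n l) w.
  rewrite -(vsubmxK w) mul_block_col rowKu rowKd mul0mx add0r; exact: rowD.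
have rowR : row (rshift n l) (block_mx 0 (diag_mx d) (- diag_mx d) 0 *m w) =
    - d 0 l *: row (lshift n l) w.
  rewrite -(vsubmxK w) mul_block_col rowKu rowKd mul0mx addr0 mulNmx.
  by rewrite linearN /= rowD scaleNr.
rewrite rowL rowR !linearZ /= -!scalerAr /plane_form /omega.
rewrite [ext_vec (row (rshift _ _) _) * _]ext_vec_anticomm scalerN scaleNr opprK.
by rewrite mulr_natl mulr2n scalerDl.
Qed.

Lemma prod_two_form_diag w (d : 'rV[C]_n) :
  \prod_(t < n) two_form w (block_mx 0 (diag_mx d) (- diag_mx d) 0) =
  (2 ^+ n * (n`!)%:R * \prod_l d 0 l) *: Omega2n w.
Proof.
rewrite two_form_diag (prod_sum_comm (plane_formC w)); last exact: plane_form_sqr.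
rewrite Omega2nE; congr (_ *: _); rewrite big_split /= prodr_const card_ord; ring.
Qed.

(** The n-th power of the form of J is computed in both bases by [prod_two_form_diag] with d = 1.
    The two forms agree by [two_form_congr], and the scalar 2^n n! cancels. This takes the place of
    showing that a symplectic matrix has determinant 1. *)
Lemma Omega2n_symplectic w T : T^T *m Jmx R n *m T = Jmx R n ->
  Omega2n (T *m w) = Omega2n w.
Proof.
move=> TJ.
have JE : Jmx R n = block_mx 0 (diag_mx (const_mx 1)) (- diag_mx (const_mx 1)) 0.
  by rewrite diag_const_mx.
have := prod_two_form_diag (T *m w) (const_mx 1).
rewrite -JE two_form_congr TJ JE prod_two_form_diag => /esym.
apply: scalerI.
rewrite big1 => [|l _]; last by rewrite mxE.
by rewrite mulr1 mulf_neq0 // ?expf_neq0 // pnatr_eq0 // -lt0n fact_gt0.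
Qed.

Lemma moore_det_two_form w (M : 'M[quat R]_n) (d : R) : is_moore_det M d ->
  \prod_(t < n) two_form w (tau M *m Jmx R n) =
  (2 ^+ n * (n`!)%:R * d)%:C *: Omega2n w.
Proof.
move=> [E [nu [EU EME ->]]].
have ME : M = E *m diag_mx (\row_l realq (nu l)) *m adjq E.
  rewrite -EME !mulmxA; case: EU => _ EE.
  by rewrite EE mul1mx -mulmxA EE mulmx1.
(* The transpose matches the shape [T^T *m K *m T] of [two_form_congr]. *)
pose T := (tau E)^T.
have TJ : T^T *m Jmx R n *m T = Jmx R n by rewrite trmxK tau_unitary.
have -> : tau M *m Jmx R n =
    T^T *m (tau (diag_mx (\row_l realq (nu l))) *m Jmx R n) *m T.
  by rewrite ME !tauM -!mulmxA tau_adjq_Jmx trmxK.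
rewrite -two_form_congr tau_diag prod_two_form_diag Omega2n_symplectic //.
congr (_ *: _); rewrite !rmorphM rmorphXn /= !rmorph_nat rmorph_prod.
by congr (_ * _); apply: eq_bigr => l _; rewrite mxE.
Qed.

Lemma Omega2n_inj w (a b : C) : w \in unitmx ->
  a *: Omega2n w = b *: Omega2n w -> a = b.
Proof.
move=> /Omega2n_neq0 O0 /eqP; rewrite -subr_eq0 -scalerBl scaler_eq0.
by rewrite (negbTE O0) orbF subr_eq0 => /eqP.
Qed.

End TwoForms.

(** * Diagonalization of hyperhermitian matrices *)

Section QuaternionicSpectral.
Variable R : realType.
Local Notation H := (quat R).
Local Notation C := R[i].

Definition sqnormq (x : H) : R :=
  complex.Re (qa x) ^+ 2 + complex.Im (qa x) ^+ 2 +
  (complex.Re (qb x) ^+ 2 + complex.Im (qb x) ^+ 2).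

Lemma sqnormq_ge0 x : 0 <= sqnormq x.
Proof. by rewrite !addr_ge0 ?sqr_ge0. Qed.

Lemma sqnormq_eq0 x : sqnormq x = 0 -> x = 0.
Proof.
case: x => [[a b] [c d]] /eqP; rewrite /sqnormq /= !paddr_eq0 ?addr_ge0 ?sqr_ge0 //.
by rewrite !sqrf_eq0 => /andP[/andP[/eqP -> /eqP ->] /andP[/eqP -> /eqP ->]].
Qed.

Lemma conjq_mul x : conjq x * x = realq (sqnormq x).
Proof.
case: x => [[a b] [c d]]; apply: quatP; rewrite ?qaM ?qbM /= /sqnormq /=;
  apply/eqP; rewrite eq_complex; simpc => /=; apply/andP; split; apply/eqP; ring.
Qed.

Lemma mul_conjq x : x * conjq x = realq (sqnormq x).
Proof.
rewrite -{1}[x]conjqK conjq_mul; congr realq.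
by case: x => [[a b] [c d]]; rewrite /sqnormq /= !sqrrN.
Qed.

Fact realq_is_zmod : zmod_morphism (@realq R).
Proof. by move=> x y; apply: quatP; rewrite /= ?rmorphB ?subr0. Qed.
HB.instance Definition _ := GRing.isZmodMorphism.Build R H (@realq R) realq_is_zmod.
Fact realq_is_monoid : monoid_morphism (@realq R).
Proof.
split=> [|x y]; first by apply: quatP; rewrite /= ?rmorph1.
by apply: quatP; rewrite ?qaM ?qbM /= ?rmorph0 ?mulr0 ?mul0r ?subr0 ?addr0 ?rmorphM.
Qed.
HB.instance Definition _ :=
  GRing.isMonoidMorphism.Build R H (@realq R) realq_is_monoid.

Lemma realq_comm (r : R) x : realq r * x = x * realq r.
Proof.
apply: quatP; rewrite ?qaM ?qbM /= ?rmorph0 ?mulr0 ?mul0r ?subr0 ?addr0 ?add0r.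
  by rewrite mulrC.
by rewrite conj_real_complex mulrC.
Qed.

Lemma conjq_realq (r : R) : conjq (realq r) = realq r.
Proof. by apply: quatP; rewrite /= ?oppr0 ?conj_real_complex. Qed.

Lemma quat_inv (x : H) : x != 0 -> exists y, y * x = 1 /\ x * y = 1.
Proof.
move=> x0; have n0 : sqnormq x != 0.
  by apply: contraNneq x0 => /sqnormq_eq0 ->.
exists (realq (sqnormq x)^-1 * conjq x); split.
  by rewrite -mulrA conjq_mul -rmorphM mulVf // rmorph1.
by rewrite mulrA -realq_comm -mulrA mul_conjq -rmorphM mulVf // rmorph1.
Qed.

Lemma scalemx_realqAr m n p (r : R) (A : 'M[H]_(m, n)) (B : 'M[H]_(n, p)) :
  A *m (realq r *: B) = realq r *: (A *m B).
Proof.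
apply/matrixP => i j; rewrite !mxE mulr_sumr.
by apply: eq_bigr => k _; rewrite !mxE !mulrA realq_comm.
Qed.

Lemma tauD m p (A B : 'M[H]_(m, p)) : tau (A + B) = tau A + tau B.
Proof.
rewrite /tau add_block_mx; apply: congr_block_mx; apply/matrixP => i j;
  by rewrite !mxE /= ?rmorphD ?opprD.
Qed.

Lemma tauZ m p (r : R) (A : 'M[H]_(m, p)) :
  tau (realq r *: A) = r%:C *: tau A.
Proof.
rewrite /tau scale_block_mx; apply: congr_block_mx; apply/matrixP => i j;
  rewrite !mxE ?qaM ?qbM /= mul0r ?subr0 ?addr0 ?rmorphM
    ?conj_real_complex ?mulrN //.
- by rewrite /= conj_real_complex.
- by rewrite /= conj_real_complex.
Qed.

Lemma tau0 m p : tau (0 : 'M[H]_(m, p)) = 0.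
Proof.
by rewrite -(scale0r 0) -(raddf0 (@realq R)) tauZ scale0r.
Qed.

Lemma adjqZ m n (r : R) (A : 'M[H]_(m, n)) : adjq (realq r *: A) = realq r *: adjq A.
Proof.
by apply/matrixP => i j; rewrite !mxE conjqM conjq_realq realq_comm.
Qed.

Lemma adjqB m n (A B : 'M[H]_(m, n)) : adjq (A - B) = adjq A - adjq B.
Proof. by apply/matrixP => i j; rewrite !mxE raddfB. Qed.

Lemma adjqN m n (A : 'M[H]_(m, n)) : adjq (- A) = - adjq A.
Proof. by apply/matrixP => i j; rewrite !mxE raddfN. Qed.

Lemma adjq1 n : adjq (1%:M : 'M[H]_n) = 1%:M.
Proof.
apply/matrixP => i j; rewrite !mxE eq_sym.
by case: eqP => _; rewrite ?raddf0 // -(rmorph1 (@realq R)) conjq_realq.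
Qed.

(** A complex eigenvector of [tau M] encodes a quaternionic [X] with M X = X lam. Hyperhermiticity
    forces lam to be real, hence central, so it may be written on the left. *)
Lemma hyperhermitian_eigenvector n (M : 'M[H]_n.+1) : hyperhermitian M ->
  exists (v : 'cV[H]_n.+1) (nu : R),
    adjq v *m v = 1%:M /\ M *m v = realq nu *: v.
Proof.
move=> hM.
(* [eigenvalueP] yields row eigenvectors, so the transpose is used to obtain a column eigenvector of
   [tau M]. *)
have [lam] := eigenvalue_closed (tau M)^T (ltn0Sn _).
case/eigenvalueP => u uE u0.
have tauE i : \sum_j tau M i j * u 0 j = lam * u 0 i.
  have := congr1 (fun X : 'rV_(n.+1 + n.+1) => X 0 i) uE; rewrite !mxE => <-.
  by apply: eq_bigr => j _; rewrite !mxE mulrC.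
(* Chosen so that the transpose of [u] is the first column of [tau X]; the lower half of that column
   is the conjugate of the j-part. *)
pose X : 'cV[H]_n.+1 := \col_k Quat (u 0 (lshift _ k)) (u 0 (rshift _ k))^*%R.
have tauEl i : \sum_j (qa (M i j) * u 0 (lshift _ j) - qb (M i j) * u 0 (rshift _ j))
    = lam * u 0 (lshift _ i).
  rewrite -tauE big_split_ord /= -big_split /=; apply: eq_bigr => j _.
  by rewrite block_mxEul block_mxEur !mxE mulNr.
have tauEr i : \sum_j ((qb (M i j))^*%R * u 0 (lshift _ j)
    + (qa (M i j))^*%R * u 0 (rshift _ j)) = lam * u 0 (rshift _ i).
  rewrite -tauE big_split_ord /= -big_split /=; apply: eq_bigr => j _.
  by rewrite block_mxEdl block_mxEdr !mxE.
have MX : M *m X = X *m (Quat lam 0)%:M.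
  apply/matrixP => i j; rewrite ord1 !mxE big_ord1 !mxE eqxx mulr1n.
  apply: quatP; rewrite raddf_sum /= ?qaM ?qbM /=.
    rewrite rmorph0 mulr0 subr0 mulrC -tauEl; apply: eq_bigr => k _.
    by rewrite !mxE /= conjCK.
  rewrite mulr0 add0r -rmorphM mulrC -tauEr rmorph_sum; apply: eq_bigr => k _.
  by rewrite !mxE /= rmorphD !rmorphM /= !conjCK addrC.
pose s := \sum_k sqnormq (X k 0).
have XX : adjq X *m X = (realq s)%:M.
  apply/matrixP => i j; rewrite !ord1 !mxE eqxx mulr1n rmorph_sum.
  by apply: eq_bigr => k _; rewrite !mxE conjq_mul.
have s0 : s != 0.
  apply: contra u0 => /eqP; rewrite /s => /eqP.
  rewrite psumr_eq0 => [/allP X0|k _]; last exact: sqnormq_ge0.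
  apply/eqP/rowP => j; rewrite [RHS]mxE.
  have Xk k : X k 0 = 0 by apply: sqnormq_eq0; apply/eqP/X0; rewrite mem_index_enum.
  case: (split_ordP j) => k ->; have := Xk k; rewrite mxE => -[] // _ /eqP.
  by rewrite conjC_eq0 => /eqP.
(* X^* M X is self-adjoint and equals s lam with s real and nonzero, so lam is its own conjugate. *)
have lamR : lam = (complex.Re lam)%:C.
  have : adjq (adjq X *m M *m X) = adjq X *m M *m X.
    by rewrite !adjqM adjqK (hyperhermitianP M).1 // mulmxA.
  rewrite -mulmxA MX mulmxA XX -scalar_mxM => /matrixP /(_ 0 0).
  rewrite !mxE eqxx !mulr1n => /(congr1 (@qa R)).
  rewrite /= ?qaM /= rmorph0 mulr0 subr0 rmorphM /= conj_real_complex.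
  have sC0 : s%:C != 0 by rewrite eq_complex /= (negbTE s0).
  move=> /(mulfI sC0); case: (lam) => x y /(congr1 (@complex.Im R)) /= Ny.
  by congr (_ +i* _); lra.
pose c := (Num.sqrt s)^-1.
have sp : 0 < s.
  by rewrite lt_neqAle eq_sym s0 sumr_ge0 // => k _; apply: sqnormq_ge0.
exists (realq c *: X), (complex.Re lam); split.
  rewrite adjqZ -scalemxAl scalemx_realqAr XX !scale_scalar_mx -!rmorphM.
  by rewrite /c mulrA -invfM -expr2 sqr_sqrtr ?ltW // mulVf // rmorph1.
rewrite scalemx_realqAr MX !scalerA realq_comm -scalerA; congr (_ *: _).
apply/matrixP => i j; rewrite ord1 !mxE big_ord1 !mxE eqxx mulr1n.
by rewrite realq_comm /realq -lamR.
Qed.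

(* A quaternionic Householder map [1 - u a u^*] with [u = e - v]: the quaternion
   [a = (u^* e)^-1] is chosen so that [e] is sent to [v]; the map is unitary
   because [u^* u = a^-1 + conj a^-1]. *)
Lemma unitary_first_col n (v : 'cV[H]_n.+1) : adjq v *m v = 1%:M -> v 0 0 != 1 ->
  exists2 U : 'M[H]_n.+1, qunitary U & U *m delta_mx 0 0 = v.
Proof.
move=> vv v1; pose e : 'cV[H]_n.+1 := delta_mx 0 0; pose u := e - v.
have ee : adjq e *m e = 1%:M.
  apply/matrixP => i j; rewrite !ord1 !mxE (bigD1 0) //= big1 => [|k /negbTE k0].
    by rewrite !mxE !eqxx addr0 mulr1; apply: quatP; rewrite /= ?rmorph1 ?oppr0.
  by rewrite !mxE k0 mulr0.
pose Q : 'M[H]_1 := adjq u *m e.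
have [a [aQ Qa]] : exists a : 'M[H]_1, a *m Q = 1%:M /\ Q *m a = 1%:M.
  have QE : Q = (1 - conjq (v 0 0))%:M.
    rewrite /Q /u adjqB mulmxBl ee; apply/matrixP => i j; rewrite !ord1 !mxE.
    rewrite eqxx mulr1n (bigD1 0) //= big1 => [|k /negbTE k0].
      by rewrite !mxE eqxx mulr1 addr0.
    by rewrite !mxE k0 mulr0.
  have /quat_inv [y [yx xy]] : 1 - conjq (v 0 0) != 0.
    apply: contra v1; rewrite subr_eq0 => /eqP v1.
    by rewrite -[v 0 0]conjqK -v1 -(rmorph1 (@realq R)) conjq_realq.
  by exists y%:M; rewrite QE -!scalar_mxM yx xy.
have uu : adjq u *m u = Q + adjq Q.
  rewrite /Q adjqM adjqK /u adjqB !mulmxBl !mulmxBr ee vv opprB addrC //.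
have adj1 : (adjq a *m adjq Q = 1%:M) * (adjq Q *m adjq a = 1%:M).
  by rewrite -!adjqM aQ Qa adjq1.
exists (1%:M - u *m a *m adjq u); last first.
  by rewrite mulmxBl mul1mx -!mulmxA -/e -/Q aQ mulmx1 opprB addrCA subrr addr0.
have UU (b c : 'M[H]_1) : b *m (Q + adjq Q) *m c = c + b ->
    (1%:M - u *m b *m adjq u) *m (1%:M - u *m c *m adjq u) = 1%:M.
  move=> bQc; rewrite mulmxBl mul1mx mulmxBr mulmx1.
  have -> : u *m b *m adjq u *m (u *m c *m adjq u) =
      u *m (b *m (adjq u *m u) *m c) *m adjq u by rewrite !mulmxA.
  by rewrite uu bQc mulmxDr mulmxDl opprB addrK subrK.
split; rewrite (adjqB 1%:M) adjq1 !adjqM adjqK !mulmxA; apply: UU.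
  by rewrite mulmxDr mulmxDl adj1 mul1mx -mulmxA Qa mulmx1 addrC.
by rewrite mulmxDr mulmxDl aQ mul1mx -mulmxA adj1 mulmx1.
Qed.

(** Deflation: once a unit eigenvector is the first column of a unitary [U], the first column of U^*
    M U is a real multiple of the first basis vector. By self-adjointness so is its first row, and
    induction applies to the remaining block [D]. *)
Lemma hyperhermitian_diagonalizable n (M : 'M[H]_n) : hyperhermitian M ->
  exists (E : 'M[H]_n) (nu : 'I_n -> R), qunitary E /\
    adjq E *m M *m E = diag_mx (\row_l realq (nu l)).
Proof.
elim: n M => [|n IH] M hM.
  by exists 1%:M, (fun=> 0); split; [split|]; apply/matrixP => -[].
have [v0 [nu0 [vv0 Mv0]]] := hyperhermitian_eigenvector hM.
(* [unitary_first_col] excludes first coordinate 1; in that case -v0 is an eigenvector for the same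
   eigenvalue with first coordinate -1. *)
have [v [vv Mv v1]] : exists v : 'cV[H]_n.+1,
    [/\ adjq v *m v = 1%:M, M *m v = realq nu0 *: v & v 0 0 != 1].
  have [v1|] := eqVneq (v0 0 0) 1; last by exists v0.
  exists (- v0); split.
  - by rewrite adjqN mulNmx mulmxN opprK.
  - by rewrite mulmxN Mv0 scalerN.
  rewrite mxE v1 -subr_eq0 -opprD oppr_eq0 -mulr2n.
  rewrite -(rmorph1 (@realq R)) -rmorphMn; apply/eqP => /(congr1 (@sqnormq)).
  by rewrite /sqnormq /= expr0n /= !addr0 => /eqP; rewrite sqrf_eq0 pnatr_eq0.
have [U [UU1 UU2] Uv] := unitary_first_col vv v1.
have [M' M'E] : exists M', M' = adjq U *m M *m U by exists (adjq U *m M *m U).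
have hM' : adjq M' = M'.
  by rewrite M'E !adjqM adjqK (hyperhermitianP M).1 // mulmxA.
have M'e : M' *m delta_mx 0 0 = realq nu0 *: delta_mx 0 0 :> 'cV_n.+1.
  by rewrite M'E -!mulmxA Uv Mv scalemx_realqAr -Uv mulmxA UU1 mul1mx.
have M'0 i : M' i 0 = realq nu0 * (i == 0)%:R.
  by have := congr1 (fun X : 'cV_n.+1 => X i 0) M'e; rewrite -colE !mxE andbT.
have M'0' j : M' 0 j = realq nu0 * (j == 0)%:R.
  rewrite -hM' !mxE M'0 conjqM conjq_realq realq_comm; congr (_ * _).
  by case: eqP => _; rewrite ?raddf0 // -(rmorph1 (@realq R)) conjq_realq.
pose D : 'M[H]_n := @drsubmx _ 1 n 1 n M'.
have M'D : M' = block_mx (realq nu0)%:M 0 0 D :> 'M_(1 + n).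
  rewrite -[M'](@submxK _ 1 n 1 n); apply: congr_block_mx;
    apply/matrixP => i j; rewrite ?ord1 !mxE.
  - by rewrite lshift0 M'0 eqxx mulr1 mulr1n.
  - by rewrite lshift0 M'0' mulr0.
  - by rewrite lshift0 M'0 mulr0.
  - by [].
have hD : hyperhermitian D.
  by move=> j k; rewrite !mxE -[in LHS]hM' !mxE.
have [E' [nu' [[E1 E2] E'D]]] := IH D hD.
pose B : 'M[H]_(1 + n) := block_mx 1%:M 0 0 E'.
have B' : adjq B = block_mx 1%:M 0 0 (adjq E').
  rewrite /adjq map_block_mx tr_block_mx; apply: congr_block_mx.
  - exact: adjq1.
  - by apply/matrixP => i j; rewrite !mxE raddf0.
  - by apply/matrixP => i j; rewrite !mxE raddf0.
  - exact: erefl.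
have [B1 B2] : qunitary B.
  split; rewrite B' mulmx_block !mulmx0 !mul0mx !mulmx1 !addr0 !add0r;
    by rewrite (E1, E2) -scalar_mx_block.
pose nu (l : 'I_(1 + n)) := oapp nu' nu0 (unlift 0 l).
exists (U *m B : 'M_n.+1), nu; split.
  split; rewrite adjqM !mulmxA.
    by rewrite -(mulmxA (adjq B)) UU1 mulmx1.
  by rewrite -(mulmxA U) B2 mulmx1.
have -> : adjq (U *m B : 'M_n.+1) *m M *m (U *m B) = adjq B *m M' *m B.
  by rewrite adjqM M'E !mulmxA.
rewrite M'D; have -> : adjq B *m block_mx (realq nu0)%:M 0 0 D *m B =
    block_mx (realq nu0)%:M 0 0 (adjq E' *m D *m E').
  rewrite B' !mulmx_block !(mulmx0, mul0mx, mulmx1, mul1mx, addr0, add0r).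
  by rewrite ?mul0mx.
have -> : block_mx (realq nu0)%:M 0 0 (adjq E' *m D *m E') =
    diag_mx (row_mx (realq nu0)%:M (\row_l realq (nu' l))).
  rewrite E'D diag_mx_row; apply: congr_block_mx => //.
  by apply/matrixP => i j; rewrite !ord1 !mxE.
apply: (congr1 (@diag_mx H n.+1)).
apply/rowP => j; rewrite !mxE /nu; case: split_ordP => k ->.
  by rewrite ord1 lshift0 unlift_none mxE eqxx mulr1n.
by rewrite rshift1 liftK mxE.
Qed.

Lemma moore_det_exists n (M : 'M[H]_n) : hyperhermitian M ->
  exists d, is_moore_det M d.
Proof.
move=> /hyperhermitian_diagonalizable [E [nu [EU ED]]].
by exists (\prod_l nu l), E, nu.
Qed.

(** Diagonalizability ensures that the choice in [moore_det] does not fall back on its default 0. *)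
Lemma moore_detP n (M : 'M[H]_n) : hyperhermitian M -> is_moore_det M (moore_det M).
Proof.
by move=> /moore_det_exists [d Md]; apply: classical_sets.xgetPex; exists d.
Qed.

End QuaternionicSpectral.

(** * Reality of the 2-forms *)

Section RealForms.
Variables (C : numClosedFieldType) (N : nat) (f : 'rV[C]_N -> 'rV[C]_N).
Local Notation ext := (ext C N).
Hypothesis fD : forall x y, f (x + y) = f x + f y.
Hypothesis fZ : forall (a : C) x, f (a *: x) = a^*%R *: f x.

Lemma ext_antilinear_sum (I : finType) (F : I -> ext) :
  ext_antilinear f (\sum_i F i) = \sum_i ext_antilinear f (F i).
Proof.
rewrite exchange_big; apply: eq_bigr => S _ /=.
by rewrite sum_ffunE rmorph_sum scaler_suml.
Qed.

Lemma ext_antilinearZ a (u : ext) :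
  ext_antilinear f (a *: u) = a^*%R *: ext_antilinear f u.
Proof.
rewrite scaler_sumr; apply: eq_bigr => S _.
by rewrite ffunE /= rmorphM scalerA.
Qed.

Lemma ext_antilinear_basis S : ext_antilinear f (ext_basis C S) =
  \prod_(A <- enum S) ext_vec (f (delta_mx 0 A)).
Proof.
rewrite /ext_antilinear (bigD1 S) //= big1 => [|T /negbTE TS].
  by rewrite ffunE eqxx rmorph1 scale1r addr0.
by rewrite ffunE TS rmorph0 scale0r.
Qed.

(** [ext_antilinear] multiplies the images of the factors in the order of [enum], which must be the
    increasing one to agree with the monomials. *)
Lemma enum_set2_lt (A B : 'I_N) : (A < B)%N -> enum [set A; B] = [:: A; B].
Proof.
move=> AB; apply: (@irr_sorted_eq _ (fun i j : 'I_N => (i < j)%N)).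
- by move=> ? ? ?; apply: ltn_trans.
- by move=> ?; rewrite ltnn.
- rewrite [enum _](_ : _ = filter (mem [set A; B]) (enum 'I_N)); last first.
    by rewrite enumT.
  apply: sorted_filter; first by move=> ? ? ?; apply: ltn_trans.
  have := iota_ltn_sorted 0 N; rewrite -val_enum_ord sorted_map.
  exact: id.
- by rewrite /= AB.
by move=> i; rewrite mem_enum !inE.
Qed.

(** Both sides are antisymmetric in A and B, so A <= B may be assumed. Equal indices give 0 on both
    sides, and for A < B the product is a monomial, where the extension is given by definition. *)
Lemma ext_antilinear_basis2 (A B : 'I_N) :
  ext_antilinear f (ext_basis C [set A] * ext_basis C [set B]) =
  ext_vec (f (delta_mx 0 A)) * ext_vec (f (delta_mx 0 B)).
Proof.
wlog AB : A B / (A <= B)%N.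
  move=> H; have /orP[/H //|/H BA] := leq_total A B.
  rewrite ext_basis1_anticomm -scaleN1r ext_antilinearZ BA.
  by rewrite rmorphN1 scaleN1r -ext_vec_anticomm.
have [<-|nAB] := eqVneq A B.
  rewrite ext_vec_sqr -ext_vec_delta ext_vec_sqr.
  by rewrite -(scale0r 0) ext_antilinearZ rmorph0 !scale0r.
have AB' : (A < B)%N by rewrite ltn_neqAle nAB.
rewrite ext_basisM disjoints1 inE -[_ == _]negbK nAB /= inversionsE !big_set1.
rewrite ltnNge AB /= expr0 scale1r ext_antilinear_basis enum_set2_lt //.
by rewrite !big_cons big_nil /= mulr1.
Qed.

(** The extension is defined on monomials; expanding both vectors in the canonical basis gives
    multiplicativity on pairs of vectors, which is what 2-forms require. *)
Lemma ext_antilinear_mul x y : ext_antilinear f (ext_vec x * ext_vec y) =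
  ext_vec (f x) * ext_vec (f y).
Proof.
have f0 : f 0 = 0 by have := fZ 0 0; rewrite rmorph0 !scale0r.
have ext_f z : ext_vec (f z) = \sum_A (z 0 A)^*%R *: ext_vec (f (delta_mx 0 A)).
  rewrite {1}(row_sum_delta z) (big_morph f fD f0) linear_sum.
  by apply: eq_bigr => A _; rewrite fZ linearZ.
rewrite !ext_f !ext_vec_sum !mulr_suml ext_antilinear_sum; apply: eq_bigr => A _.
rewrite !mulr_sumr ext_antilinear_sum; apply: eq_bigr => B _.
rewrite -[in LHS]scalerAl -[in LHS]scalerAr !ext_antilinearZ ext_antilinear_basis2.
by rewrite -[in RHS]scalerAl -[in RHS]scalerAr.
Qed.

End RealForms.

(** * Reality of the 2-form of tau M J *)

Section TwoFormReal.
Variables (R : realType) (n : nat) (w : 'M[R[i]]_(n + n)).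
Hypothesis w_unit : w \in unitmx.
Local Notation C := R[i].

Lemma rhojD x y : rhoj w (x + y) = rhoj w x + rhoj w y.
Proof. by rewrite /rhoj mulmxDl map_mxD !mulmxDl. Qed.

Lemma rhojZ (a : C) x : rhoj w (a *: x) = a^*%R *: rhoj w x.
Proof. by rewrite /rhoj -scalemxAl map_mxZ -!scalemxAl. Qed.

Lemma rhoj_row A : rhoj w (row A w) = row A (Jmx R n *m w).
Proof.
by rewrite /rhoj -row_mul mulmxV // map_row map_mx1 -!row_mul mul1mx.
Qed.

(** [rhoj] maps the rows of [w] to the rows of J w and conjugates coefficients; [two_form_congr]
    then gives J^T K^* J, where K^* is the entrywise conjugate and J^T = -J. *)
Lemma ext_antilinear_two_form K : ext_antilinear (rhoj w) (two_form w K) =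
  two_form w (- (Jmx R n *m map_mx Num.conj K *m Jmx R n)).
Proof.
rewrite -mulNmx -mulNmx -Jmx_tr -two_form_congr /two_form ext_antilinear_sum.
apply: eq_bigr => A _; rewrite ext_antilinear_sum; apply: eq_bigr => B _.
by rewrite ext_antilinearZ (ext_antilinear_mul rhojD rhojZ) !rhoj_row mxE.
Qed.

Lemma real_form_tau (M : 'M[quat R]_n) : real_form w (two_form w (tau M *m Jmx R n)).
Proof.
rewrite /real_form ext_antilinear_two_form; congr two_form.
have JJ : map_mx Num.conj (Jmx R n) = Jmx R n.
  apply/matrixP => i j; rewrite !mxE.
  by case: split => k; rewrite !mxE; case: split => l;
    rewrite !mxE ?rmorph0 ?rmorphN ?rmorph_nat.
have -> : map_mx Num.conj (tau M *m Jmx R n) = map_mx Num.conj (tau M) *m Jmx R n.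
  by rewrite -{2}JJ; apply: map_mxM.
(* [tau_Jmx] replaces J times the conjugate of [tau M] by [tau M] times J, and J^2 = -1 removes the
   remaining sign. *)
by rewrite mulmxA -tau_Jmx -!mulmxA Jmx_sqr mulmxN mulmx1 mulmxN opprK.
Qed.

End TwoFormReal.

(** * The mixed discriminant *)

Section PolynomialIdentities.
Variable K : numFieldType.

(** The naturals below [size p] are pairwise distinct roots, too many for a nonzero polynomial. *)
Lemma poly_vanishing_eq0 (p : {poly K}) : (forall x, p.[x] = 0) -> p = 0.
Proof.
move=> p0; apply: (@roots_geq_poly_eq0 _ _ [seq i%:R | i <- iota 0 (size p)]).
- by apply/allP => x _; apply/rootP/p0.
- rewrite map_inj_uniq ?iota_uniq // => i j /eqP.
  by rewrite eqr_nat => /eqP.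
- by rewrite size_map size_iota.
Qed.

(** Induction on the number of variables: [muni] views p as a polynomial in the last variable, whose
    coefficients vanish at every point by the univariate case and hence are 0. *)
Lemma mpoly_vanishing_eq0 n (p : {mpoly K[n]}) :
  (forall v : 'I_n -> K, p.@[v] = 0) -> p = 0.
Proof.
elim: n p => [|n IH] p p0; apply/mpolyP => m; rewrite mcoeff0.
  have [pm|] := boolP (m \in msupp p); last exact: memN_msupp_eq0.
  rewrite -[RHS](p0 (fun=> 0)) mevalE (bigD1_seq m) //= big_ord0 mulr1.
  rewrite big1_seq ?addr0 // => m' /andP[m'm _]; case/eqP: m'm.
  by apply/mnmP => -[].
pose last_val (v : 'I_n -> K) x (i : 'I_n.+1) : K :=
  if unlift ord_max i is Some j then v j else x.
have widenE (i : 'I_n) : widen_ord (leqnSn n) i = lift ord_max i.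
  by apply: val_inj; rewrite /= /bump leqNgt ltn_ord.
have eval_muni v x : (map_poly (meval v) (muni p)).[x] = p.@[last_val v x].
  rewrite muniE mevalE rmorph_sum horner_sum; apply: eq_bigr => k _ /=.
  rewrite map_polyZ map_polyXn hornerZ hornerXn /= mevalZ mevalX.
  rewrite big_ord_recr /= mulrA.
  rewrite {2}/last_val unlift_none; congr (_ * _ * _); apply: eq_bigr => i _.
  by rewrite mnmE widenE /last_val liftK.
have muni0 : muni p = 0.
  apply/polyP => k; rewrite coef0; apply: IH => v.
  have /polyP/(_ k) : map_poly (meval v) (muni p) = 0.
    by apply: poly_vanishing_eq0 => x; rewrite eval_muni p0.
  by rewrite coef_map coef0.
have [pm|] := boolP (m \in msupp p); last exact: memN_msupp_eq0.
pose m' := [multinom m (widen_ord (leqnSn n) i) | i < n].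
(* The coefficient of m in p is read off [muni p] in two stages: the exponent of the last variable,
   then the remaining exponents m'. *)
have := congr1 (fun q : {poly {mpoly K[n]}} => (q`_(m ord_max))@_m') muni0.
rewrite coef0 mcoeff0 muniE coef_sum linear_sum /= (bigD1_seq m) //=.
rewrite coefZ coefXn eqxx mulr1 mcoeffZ mcoeffX eqxx mulr1.
rewrite big1_seq ?addr0 // => k /andP[km _].
rewrite coefZ coefXn; have [kmax|_] := eqVneq; last by rewrite mulr0 mcoeff0.
rewrite mulr1 mcoeffZ mcoeffX; have [/mnmP km'|_] := eqVneq; last by rewrite mulr0.
case/eqP: km; apply/mnmP => i; case: (unliftP ord_max i) => [j ->|->] //.
by have := km' j; rewrite !mnmE widenE.
Qed.

Variables (n : nat) (a : {ffun 'I_n -> 'I_n} -> K).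

(** The shape of an expanded n-th power of a linear combination: one term per word f of length n,
    equal monomials not being collected. *)
Definition index_mpoly : {mpoly K[n]} :=
  \sum_(f : {ffun 'I_n -> 'I_n}) a f *: \prod_(i < n) 'X_(f i).

Lemma index_mpoly_eval v :
  index_mpoly.@[v] = \sum_(f : {ffun 'I_n -> 'I_n}) a f * \prod_(i < n) v (f i).
Proof.
rewrite rmorph_sum; apply: eq_bigr => f _ /=.
rewrite mevalZ rmorph_prod; congr (_ * _).
by apply: eq_bigr => i _; rewrite /= mevalXU.
Qed.

(** Exactly the words that are permutations produce the squarefree monomial in all variables, and
    there are [n!] of them. *)
Lemma index_mpoly_coef c :
  (forall f : {ffun 'I_n -> 'I_n}, injective f -> a f = c) ->
  index_mpoly@_[multinom 1%N | i < n] = (n`!)%:R * c.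
Proof.
move=> ac; rewrite linear_sum /= (bigID (fun f : {ffun _} => injectiveb f)) /=.
have coefE (f : {ffun 'I_n -> 'I_n}) :
    (a f *: \prod_(i < n) 'X_(f i))@_[multinom 1%N | i < n] =
    if injectiveb f then a f else 0.
  rewrite mcoeffZ mprodXE mcoeffX; case: ifP => fI.
    rewrite (_ : _ == _) ?mulr1 //; apply/eqP/mnmP => j.
    rewrite mnm_sumE mnmE (bigD1 (invF (injectiveP _ fI) j)) //= mnm1E f_invF eqxx.
    rewrite big1 // => i ij; rewrite mnm1E; apply/eqP; rewrite eqb0.
    by apply: contra ij => /eqP <-; rewrite invF_f.
  rewrite (_ : (_ == _) = false) ?mulr0 //; apply: contraFF fI => /eqP/mnmP E.
  apply/injectiveP => i j fij; apply/eqP; apply: contraT => ij.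
  have := E (f i); rewrite mnm_sumE mnmE (bigD1 i) //= (bigD1 j) 1?eq_sym //=.
  by rewrite !mnm1E fij eqxx.
rewrite [X in _ + X]big1 ?addr0 => [|f fNI]; last by rewrite coefE (negbTE fNI).
rewrite (eq_bigr (fun=> c)) => [|f fI]; last first.
  by rewrite coefE fI; apply/ac/injectiveP.
by rewrite sumr_const card_injective_ffun mulr_natl.
Qed.

End PolynomialIdentities.

(** * Comparing coefficients with the mixed discriminant *)

Section MixedDiscriminant.
Variables (R : realType) (n : nat) (w : 'M[R[i]]_(n + n)).
Variable M : 'I_n -> 'M[quat R]_n.
Hypothesis w_unit : w \in unitmx.
Hypothesis M_hyp : forall t, hyperhermitian (M t).
Local Notation C := R[i].
Local Notation form_of t := (two_form w (tau (M t) *m Jmx R n)).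

Lemma hyperhermitian_comb (lam : 'I_n -> R) :
  hyperhermitian (\sum_t realq (lam t) *: M t).
Proof.
move=> j k; rewrite !summxE raddf_sum; apply: eq_bigr => t _.
by rewrite !mxE /= conjqM conjq_realq -M_hyp realq_comm.
Qed.

(** The scalar [c f] is the value that the triangle operation should take on the reindexed family;
    it is a priori complex. *)
Lemma index_forms : exists c : {ffun 'I_n -> 'I_n} -> C,
  forall f : {ffun 'I_n -> 'I_n}, \prod_(i < n) form_of (f i) = c f *: Omega2n w.
Proof.
have [c cP] := boolp.choice (fun f : {ffun 'I_n -> 'I_n} =>
  prod_two_form_Omega2n (fun i => tau (M (f i)) *m Jmx R n) w_unit).
by exists c.
Qed.

Section Coefficients.
Variable c : {ffun 'I_n -> 'I_n} -> C.
Hypothesis cP : forall f : {ffun 'I_n -> 'I_n},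
  \prod_(i < n) form_of (f i) = c f *: Omega2n w.

(** The n-th power of the 2-form of the combination is evaluated twice: by expansion over words and
    by [moore_det_two_form]. *)
Lemma moore_det_comb (lam : 'I_n -> R) :
  \sum_(f : {ffun 'I_n -> 'I_n}) (\prod_i lam (f i))%:C * c f =
  (2 ^+ n * (n`!)%:R * moore_det (\sum_t realq (lam t) *: M t))%:C.
Proof.
apply: (Omega2n_inj w_unit).
rewrite -(moore_det_two_form _ (moore_detP (hyperhermitian_comb lam))).
rewrite (big_morph _ (@tauD R n n) (tau0 R n n)) mulmx_suml linear_sum /=.
rewrite bigA_distr_bigA /= scaler_suml; apply: eq_bigr => f _.
rewrite -scalerA -cP rmorph_prod -scaler_prod; apply: eq_bigr => i _.
by rewrite tauZ -scalemxAl linearZ.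
Qed.

Lemma index_coef_inj (f g : {ffun 'I_n -> 'I_n}) :
  injective f -> injective g -> c f = c g.
Proof.
move=> fI gI; apply: (Omega2n_inj w_unit); rewrite -!cP.
pose x t : ext C (n + n) := form_of t.
have xC t s : x t * x s = x s * x t by apply: two_formC.
have prod_inj h : injective h -> \prod_(i < n) x (h i) = \prod_(i < n) x i.
  exact: (prod_inj_comm xC).
by transitivity (\prod_(i < n) x i); [|apply/esym]; apply: prod_inj.
Qed.

Lemma Re_scale (r : R) (z : C) : complex.Re (r%:C * z) = r * complex.Re z.
Proof. by case: z => x y; simpc. Qed.

Lemma Im_scale (r : R) (z : C) : complex.Im (r%:C * z) = r * complex.Im z.
Proof. by case: z => x y; simpc. Qed.

(** [moore_det_comb] is split into real and imaginary parts, since [moore_poly] has real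
    coefficients. The coefficient of the squarefree monomial is then [n!] times the corresponding
    part of [c f]. *)
Lemma mixed_discriminant_index (f : {ffun 'I_n -> 'I_n}) : injective f ->
  c f = (2 ^+ n * (n`!)%:R * mixed_discriminant M)%:C.
Proof.
move=> fI; pose k : R := 2 ^+ n * (n`!)%:R.
have nf0 : (n`!)%:R != 0 :> R by rewrite pnatr_eq0 -lt0n fact_gt0.
have k0 : k != 0 by rewrite mulf_neq0 // ?expf_neq0 // pnatr_eq0.
pose pRe := index_mpoly (fun g => complex.Re (c g)).
pose pIm := index_mpoly (fun g => complex.Im (c g)).
have ReE lam : pRe.@[lam] = k * moore_det (\sum_t realq (lam t) *: M t).
  have := congr1 (@complex.Re R) (moore_det_comb lam); rewrite /= => <-.
  rewrite index_mpoly_eval raddf_sum; apply: eq_bigr => g _.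
  by rewrite /= Re_scale mulrC.
have ImE : pIm = 0.
  apply: mpoly_vanishing_eq0 => lam.
  have := congr1 (@complex.Im R) (moore_det_comb lam); rewrite /= => <-.
  rewrite index_mpoly_eval raddf_sum; apply: eq_bigr => g _.
  by rewrite /= Im_scale mulrC.
(* The polynomial [pRe] divided by [k] is a witness, so [moore_poly] is not the default 0. *)
have pP : is_moore_poly M (moore_poly M).
  apply: classical_sets.xgetPex; exists (k^-1 *: pRe) => lam.
  by rewrite mevalZ ReE mulKf.
(* Polynomials with the same values are equal, which identifies the chosen polynomial. *)
have pE : k *: moore_poly M = pRe.
  apply/eqP; rewrite -subr_eq0; apply/eqP/mpoly_vanishing_eq0 => lam.
  by rewrite mevalB mevalZ pP ReE subrr.
have Re_coef := index_mpoly_coef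
  (fun g gI => congr1 (@complex.Re R) (index_coef_inj gI fI)).
have Im_coef := index_mpoly_coef
  (fun g gI => congr1 (@complex.Im R) (index_coef_inj gI fI)).
have Im0 : complex.Im (c f) = 0.
  apply: (mulfI nf0); rewrite mulr0 -Im_coef.
  by rewrite -/pIm ImE mcoeff0.
(* The [n!] from counting permutations cancels the division by [n!] in [mixed_discriminant]. *)
have ReM : complex.Re (c f) = 2 ^+ n * (n`!)%:R * mixed_discriminant M.
  apply: (mulfI nf0); rewrite -Re_coef -/pRe -pE mcoeffZ /mixed_discriminant -/k.
  by rewrite mulrCA [(_)%:R * (_ / _)]mulrC divfK.
by rewrite -ReM; case: (c f) Im0 => x y /= ->.
Qed.

End Coefficients.
End MixedDiscriminant.

Theorem theorem1p2 (R : realType) (n : nat) (hn : (1 <= n)%N)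
  (w : 'M[R[i]]_(n + n)) (hw : w \in unitmx)
  (M : 'I_n -> 'M[quat R]_n) (hM : forall t, hyperhermitian (M t)) :
  (2 ^+ n * (n`!)%:R * mixed_discriminant M)%:C =
  triangle w (fun t => tau (M t) *m Jmx R n).
Proof.
have [c cP] := index_forms M hw.
(* The identity word gives the product of the forms in their original order. *)
pose id_f : {ffun 'I_n -> 'I_n} := [ffun i => i].
have id_inj : injective id_f by move=> i j; rewrite !ffunE.
rewrite -(mixed_discriminant_index hw hM cP id_inj).
have prodE : \prod_(t < n) two_form w (tau (M t) *m Jmx R n) = c id_f *: Omega2n w.
  by rewrite -cP; apply: eq_bigr => i _; rewrite ffunE.
have triP : is_triangle w (fun t => tau (M t) *m Jmx R n) (c id_f).
  split=> [t|]; last exact: esym prodE.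
  by split; [apply: tau_skew|apply: real_form_tau].
(* Since [c id_f] qualifies, [triangle] is a genuine value and not the default 0; as [Omega2n w] is
   nonzero, the two values agree. *)
have [_ triE] : is_triangle w (fun t => tau (M t) *m Jmx R n)
    (triangle w (fun t => tau (M t) *m Jmx R n)).
  by apply: classical_sets.xgetPex; exists (c id_f).
by apply: (Omega2n_inj hw); rewrite triE.
Qed.
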